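(* Let $w$ be the standard Sturmian word of slope $\alpha$, with $\alpha$ irrational and $0<\alpha<1/2$, and let $[0;d_0+1,d_1,\ldots]$, with $d_0>0$, be the continued fraction expansion of $\alpha$. The word $ba^{-1}w$, obtained from $w$ by replacing its first letter $a$ with $b$, can be written as an infinite product of squares of reversed standard words in the following way: $$ba^{-1}w=\prod_{n\ge 0}(u_n^{-1}u_{n+1})^2,$$ where each $u_n^{-1}u_{n+1}$, $n\ge 0$, is the reversal of a standard word. In other words, $$w=a^{d_0}ba^{d_0-1}\prod_{n\ge 1}(u_n^{-1}u_{n+1})^2.$$
   Context: Let $\Sigma=\{a,b\}$. Let $\alpha$ be irrational with $0<\alpha<1$ and continued fraction expansion $[0;d_0+1,d_1,d_2,\ldots]$ (so $d_0\ge 0$ and $d_n\ge 1$ for $n\ge 1$). Define $s_{-1}=b$, $s_0=a$, $s_{n+1}=s_n^{d_n}s_{n-1}$ for $n\ge 0$. The sequence $(s_n)_{n\ge -1}$ is called the standard sequence of the infinite word $w_\alpha$ to which it converges; $w_\alpha$ is the standard Sturmian word of slope $\alpha$. It starts with $a$ if and only if $d_0>0$, i.e. $\alpha<1/2$. A standard word is a finite word belonging to some standard sequence (for some such $\alpha$). For $n\ge -1$, $u_n$ is the element of the free group on $\Sigma$ defined by $s_n=u_nxy$, where $xy=ab$ if $n$ is odd and $xy=ba$ if $n$ is even. Thus $u_{-1}=a^{-1}$, $u_0=b^{-1}$. Expressions such as $u_n^{-1}u_{n+1}$ are computed in the free group. The reversal of a word is the word read from right to left. An infinite product of nonempty words is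 their infinite concatenation from left to right. *)

(* Defs.v *)
From HB Require Import structures.
From mathcomp Require Import all_boot all_order all_algebra.
From mathcomp Require Import all_classical all_reals all_analysis.

Set Implicit Arguments.
Unset Strict Implicit.
Unset Printing Implicit Defensive.

Import Order.TTheory GRing.Theory Num.Theory.
Import numFieldNormedType.Exports.

(* The free group on T is modelled by reduced words; the letter (x, true)
   stands for x and (x, false) for x^-1. *)
Section FreeGroup.
Context (T : choiceType).
Implicit Types (x : T * bool) (s t : seq (T * bool)).

Definition sinv x := (x.1, ~~ x.2).

Definition reduced s := sorted (fun x y => y != sinv x) s.

Record freeGroup := FreeGroup { fgval : seq (T * bool); _ : reduced fgval }.

HB.instance Definition _ := [isSub for fgval].
HB.instance Definition _ := [Choice of freeGroup by <:].

Definition fgcons x s :=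
  if s is y :: s' then if y == sinv x then s' else x :: s else [:: x].

(* the reduced form of s ++ t, when t is reduced *)
Definition fgmulseq s t := foldr fgcons t s.

Definition fginvseq s := rev (map sinv s).

Lemma sinvK : involutive sinv.
Proof. by case=> x b; rewrite /sinv /= negbK. Qed.

Lemma fgcons_reduced x s : reduced s -> reduced (fgcons x s).
Proof.
case: s => [|y s] //= ys; case: eqP => [_|/eqP yx] /=; last by rewrite yx.
exact: path_sorted ys.
Qed.

Lemma fgconsK x s : reduced s -> fgcons x (fgcons (sinv x) s) = s.
Proof.
case: s => [|y s] /=; first by rewrite eqxx.
rewrite sinvK; have [->|yx] := eqVneq y x; last by rewrite /= eqxx.
by case: s => [|z s] //= /andP[/negPf-> _].
Qed.

Lemma fgmulseq_reduced s t : reduced t -> reduced (fgmulseq s t).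
Proof. by move=> rt; elim: s => //= x s; exact: fgcons_reduced. Qed.

Lemma fgmulseqs0 s : reduced s -> fgmulseq s [::] = s.
Proof.
elim: s => //= x s IHs xs; rewrite IHs; last exact: path_sorted xs.
by case: s xs {IHs} => //= y s /andP[/negPf-> _].
Qed.

Lemma fgmul_cons x s t : reduced t ->
  fgmulseq (fgcons x s) t = fgcons x (fgmulseq s t).
Proof.
move=> rt; case: s => //= y s; case: eqP => //= ->.
by rewrite fgconsK // fgmulseq_reduced.
Qed.

Lemma fgmulseqA s1 s2 s3 : reduced s3 ->
  fgmulseq s1 (fgmulseq s2 s3) = fgmulseq (fgmulseq s1 s2) s3.
Proof. by move=> r3; elim: s1 => //= x s1 ->; rewrite fgmul_cons. Qed.

Lemma fginvseq_reduced s : reduced s -> reduced (fginvseq s).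
Proof.
rewrite /reduced /fginvseq rev_sorted sorted_map; apply: sub_sorted => x y /=.
by apply: contra => /eqP ->; rewrite sinvK.
Qed.

Lemma fginvseqK : involutive fginvseq.
Proof. by move=> s; rewrite /fginvseq map_rev revK (mapK sinvK). Qed.

Lemma fgmulseqV s : fgmulseq (fginvseq s) s = [::].
Proof.
by elim: s => //= x s IHs; rewrite /fginvseq /= rev_cons /fgmulseq foldr_rcons /=
  sinvK eqxx.
Qed.

Definition fgone := @FreeGroup [::] isT.
Definition fgmul (g h : freeGroup) := FreeGroup (fgmulseq_reduced (val g) (valP h)).
Definition fginv (g : freeGroup) := FreeGroup (fginvseq_reduced (valP g)).

Lemma fgmulA : associative fgmul.
Proof. by move=> g h k; apply: val_inj; rewrite /= fgmulseqA // (valP k). Qed.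

Lemma fgmul1g : left_id fgone fgmul.
Proof. by move=> g; exact: val_inj. Qed.

Lemma fgmulg1 : right_id fgone fgmul.
Proof. by move=> g; apply: val_inj; rewrite /= fgmulseqs0 // (valP g). Qed.

Lemma fgmulVg : left_inverse fgone fginv fgmul.
Proof. by move=> g; apply: val_inj; exact: fgmulseqV. Qed.

Lemma fgmulgV : right_inverse fgone fginv fgmul.
Proof.
by move=> g; apply: val_inj; rewrite /= -{1}[fgval g]fginvseqK fgmulseqV.
Qed.

HB.instance Definition _ :=
  isGroup.Build freeGroup fgmulA fgmul1g fgmulg1 fgmulVg fgmulgV.

Definition fggen (x : T) : freeGroup := @FreeGroup [:: (x, true)] isT.

Definition fgword (s : seq T) : freeGroup :=
  (\prod_(x <- s) fggen x)%g.

End FreeGroup.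

Inductive letter := La | Lb.

Definition bool_of_letter x := if x is La then true else false.
Definition letter_of_bool (c : bool) := if c then La else Lb.

Lemma bool_of_letterK : cancel bool_of_letter letter_of_bool.
Proof. by case. Qed.

HB.instance Definition _ := Choice.copy letter (can_type bool_of_letterK).

Definition infword := nat -> letter.

Definition infcat (s : seq letter) (w : infword) : infword :=
  fun i => if i < size s then nth La s i else w (i - size s).

(* The concatenation v 0 ++ v 1 ++ ... of nonempty words: the first i.+1
   factors have total length greater than i, so the default letter La is
   never used. *)
Definition infprod (v : nat -> seq letter) : infword :=
  fun i => nth La (flatten (mkseq v i.+1)) i.

Definition replace_first (x : letter) (w : infword) : infword :=
  fun i => if i == 0 then x else w i.

Definition word_limit (v : nat -> seq letter) (w : infword) :=
  forall m, exists N, forall n, N <= n -> take m (v n) = mkseq w m.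

(* Indices are shifted by one: sstd d k is s_{k-1}, so that s_{-1} = b is
   sstd d 0 and s_n is sstd d n.+1. *)
Fixpoint sstd (d : nat -> nat) (k : nat) : seq letter :=
  match k with
  | 0 => [:: Lb]
  | k'.+1 => if k' is k''.+1
             then flatten (nseq (d k'') (sstd d k')) ++ sstd d k''
             else [:: La]
  end.

(* Same shift: ustd d k is u_{k-1} = s_{k-1} (xy)^-1, where k - 1 is odd
   exactly when k is even. *)
Definition ustd (d : nat -> nat) (k : nat) : freeGroup letter :=
  (fgword (sstd d k) *
   (fgword (if odd k then [:: Lb; La] else [:: La; Lb]))^-1)%g.

(* cf_convergent a n is [0; a_0, ..., a_{n-1}]. *)
Fixpoint cf_convergent (R : realType) (a : nat -> nat) (n : nat) : R :=
  (if n is n'.+1 then ((a 0)%:R + cf_convergent R (fun i => a i.+1) n')^-1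
   else 0)%R.

(* alpha = [0; d_0 + 1, d_1, d_2, ...] *)
Definition cf_expansion (R : realType) (alpha : R) (d : nat -> nat) : Prop :=
  (forall n, 0 < n -> 0 < d n) /\
  (cf_convergent R (fun i => if i == 0 then (d 0).+1 else d i) n
     @[n --> \oo] --> alpha)%classic.

Definition standard_sturmian (R : realType) (alpha : R) (w : infword) : Prop :=
  exists2 d, cf_expansion alpha d & word_limit (sstd d) w.

Definition standard_word (R : realType) (t : seq letter) : Prop :=
  exists (alpha : R) (d : nat -> nat),
    [/\ irrational alpha, (0 < alpha < 1)%R, cf_expansion alpha d &
        exists k, t = sstd d k].

(* Main.v *)
(* Write e_k for the two letters xy with s_k = u_k e_k. In the free group,
   u_{k-1} e_{k-1} u_k = u_k e_k u_{k-1}, that is, s_{k-1} and s_k commute up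
   to their last two letters; this follows by induction from
   s_{k+1} = s_k^{d_k} s_{k-1}. The identity implies that
   u_n^{-1} u_{n+1} is the reversal of s_n^{d_n - 1} s_{n-1}, and, again by
   induction, that the product of the first N squares is b a^{-1} s_N u_N.
   As u_N is a positive word for N >= 1, the word obtained from s_N by replacing
   its first letter with b is a prefix of that product.

   The word s_n^{d_n - 1} s_{n-1} is standard for the expansion with d_n
   decreased by one. That expansion has an irrational value because it has the
   same tail as the expansion of alpha. *)
Require Import Defs.
From HB Require Import structures.
From mathcomp Require Import all_boot all_order all_algebra.
From mathcomp Require Import all_classical all_reals all_analysis.
From mathcomp Require Import lra.

Set Implicit Arguments.
Unset Strict Implicit.
Unset Printing Implicit Defensive.

Import Order.TTheory GRing.Theory Num.Theory.
Import numFieldNormedType.Exports.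

(** * Continued fractions with irrational value *)

Lemma irrational_inv_subn (R : realType) (x : R) (n : nat) :
  irrational x -> irrational (x^-1 - n%:R)%R.
Proof.
move=> xirr [q _ qE]; apply: xirr; exists ((q + n%:R)^-1)%R => //.
by rewrite fmorphV rmorphD /= ratr_nat qE subrK invrK.
Qed.

Lemma irrational_addn_inv (R : realType) (y : R) (n : nat) :
  irrational y -> irrational (n%:R + y)^-1%R.
Proof.
move=> yirr [q _ qE]; apply: yirr; exists (q^-1 - n%:R)%R => //.
by rewrite rmorphB fmorphV /= ratr_nat qE invrK addrC addKr.
Qed.

Lemma irrational_neqn (R : realType) (x : R) (n : nat) :
  irrational x -> x != n%:R%R.
Proof.
move=> xirr; apply/eqP => xn; apply: xirr; exists n%:R%R => //.
by rewrite ratr_nat xn.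
Qed.

Lemma cf_convergent_bounds (R : realType) (a : nat -> nat) (n : nat) :
  (forall i, 0 < a i) -> (0 <= cf_convergent R a n <= 1)%R.
Proof.
elim: n a => [|n IHn] a a_gt0 /=; first by rewrite lexx ler01.
have /andP[c0 _] := IHn _ (fun i => a_gt0 i.+1).
have a1 : (1 <= (a 0)%:R :> R)%R by rewrite ler1n.
by rewrite invr_ge0 invf_le1; lra.
Qed.

(** Unlike in [cf_expansion], all quotients are treated alike, so the notion survives dropping the
    first one; irrationality keeps the inverted limits away from 0. *)
Definition cf_value (R : realType) (a : nat -> nat) (x : R) :=
  [/\ forall i, 0 < a i, irrational x &
      (cf_convergent R a @ \oo --> x)%classic].

Lemma cf_value_itv (R : realType) (a : nat -> nat) (x : R) :
  cf_value a x -> (0 < x < 1)%R.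
Proof.
move=> [a_gt0 xirr ax].
have bnd n : (0 <= cf_convergent R a n <= 1)%R by exact: cf_convergent_bounds.
have x0 : (0 <= x)%R.
  by apply: cvgr_to_ge ax _; apply: nearW => n; case/andP: (bnd n).
have x1 : (x <= 1)%R.
  by apply: cvgr_to_le ax _; apply: nearW => n; case/andP: (bnd n).
by rewrite !lt_neqAle x0 x1 eq_sym (irrational_neqn 0 xirr)
  (irrational_neqn 1 xirr).
Qed.

Lemma cf_value_behead (R : realType) (a : nat -> nat) (x : R) :
  cf_value a x -> cf_value (a \o succn) (x^-1 - (a 0)%:R)%R.
Proof.
move=> [a_gt0 xirr ax]; split=> [i|//|]; first exact: a_gt0.
  exact: irrational_inv_subn.
have -> : cf_convergent R (a \o succn) =
    (fun n => (cf_convergent R a n.+1)^-1 - (a 0)%:R)%R.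
  by apply/funext => n /=; rewrite invrK addrC addKr.
apply: cvgB; last exact: cvg_cst.
apply: cvgV; first exact: (irrational_neqn 0).
by move: ax; rewrite -cvg_shiftS.
Qed.

Lemma cf_value_cons (R : realType) (a : nat -> nat) (y : R) :
  0 < a 0 -> cf_value (a \o succn) y -> cf_value a ((a 0)%:R + y)^-1%R.
Proof.
move=> a0_gt0 ay; have /andP[y0 _] := cf_value_itv ay.
have [a_gt0 yirr ay_cvg] := ay; split; first by case.
  exact: irrational_addn_inv.
rewrite -cvg_shiftS; apply: cvgV.
  by apply: lt0r_neq0; rewrite ltr_pwDr.
by apply: cvgD => //; exact: cvg_cst.
Qed.

(** [a 0] is the integer part of [x^-1], since [x^-1 - a 0] lies strictly between 0 and 1; the tails
    follow by induction. *)
Lemma cf_value_inj (R : realType) (a b : nat -> nat) (x : R) :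
  cf_value a x -> cf_value b x -> a =1 b.
Proof.
move=> ax bx i; elim: i a b x ax bx => [|i IHi] a b x ax bx.
all: have ax' := cf_value_behead ax; have bx' := cf_value_behead bx.
all: have ab0 : a 0 = b 0.
1,3: have /andP[? ?] := cf_value_itv ax'; have /andP[? ?] := cf_value_itv bx'.
1,2: by apply/eqP; rewrite eqn_leq; apply/andP; split;
    rewrite -ltnS -(ltr_nat R) -natr1; lra.
- exact: ab0.
- by rewrite ab0 in ax'; exact: IHi ax' bx'.
Qed.

(** The first [n] quotients of [a] are stripped and those of [b] put in their place, so convergence
    is inherited from [a]. *)
Lemma cf_value_eq_tail (R : realType) (a b : nat -> nat) (n : nat) (x : R) :
  cf_value a x -> (forall i, 0 < b i) -> (forall i, n <= i -> b i = a i) ->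
  exists y : R, cf_value b y.
Proof.
elim: n a b x => [|n IHn] a b x ax b_gt0 ba.
  by exists x; have -> : b = a by apply/funext => i; exact: ba.
have [y by_] := IHn _ _ _ (cf_value_behead ax) (fun i => b_gt0 i.+1)
  (fun i => ba i.+1).
by exists ((b 0)%:R + y)^-1%R; exact: cf_value_cons.
Qed.

Definition cf_quotients (d : nat -> nat) i := if i == 0 then (d 0).+1 else d i.

Lemma cf_quotients_inj (d d' : nat -> nat) :
  cf_quotients d =1 cf_quotients d' -> d =1 d'.
Proof. by move=> dd' [|i]; [have [] := dd' 0 | exact: (dd' i.+1)]. Qed.

Lemma cf_expansion_value (R : realType) (alpha : R) (d : nat -> nat) :
  irrational alpha -> cf_expansion alpha d -> cf_value (cf_quotients d) alpha.
Proof. by move=> airr [d_gt0 ad]; split=> // -[|i] //=; exact: d_gt0. Qed.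

Lemma cf_expansion_inj (R : realType) (alpha : R) (d d' : nat -> nat) :
  irrational alpha -> cf_expansion alpha d -> cf_expansion alpha d' -> d = d'.
Proof.
move=> airr ad ad'; apply/funext/cf_quotients_inj.
by apply: cf_value_inj; apply: (cf_expansion_value airr).
Qed.

(** [alpha^-1] exceeds 2 and is less than [d 0 + 2]. *)
Lemma cf_expansion_head_gt0 (R : realType) (alpha : R) (d : nat -> nat) :
  irrational alpha -> (0 < alpha)%R -> (alpha < 2^-1)%R ->
  cf_expansion alpha d -> 0 < d 0.
Proof.
move=> airr a0 a2 /(cf_expansion_value airr)/cf_value_behead/cf_value_itv.
case/andP=> _; rewrite /cf_quotients /= -ltnS -(ltr_nat R).
have : (2 < alpha^-1)%R by rewrite -[2%R]invrK ltf_pV2 // posrE invr_gt0.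
by rewrite -!natr1; lra.
Qed.

Lemma cf_expansion_eq_tail (R : realType) (alpha : R) (d d' : nat -> nat)
    (n : nat) :
  irrational alpha -> cf_expansion alpha d ->
  (forall i, 0 < i -> 0 < d' i) -> (forall i, n <= i -> d' i = d i) ->
  exists beta : R,
    [/\ irrational beta, (0 < beta < 1)%R & cf_expansion beta d'].
Proof.
move=> airr ad d'_gt0 d'd.
have [||beta bd'] := @cf_value_eq_tail R _ (cf_quotients d') n alpha
  (cf_expansion_value airr ad).
- by case=> [|i] //=; exact: d'_gt0.
- by move=> i ni; rewrite /cf_quotients; case: eqP => [i0|_];
    rewrite -?d'd // -i0.
by exists beta; split; [case: bd' | exact: cf_value_itv bd' | split; case: bd'].
Qed.

(** * Words in the free group *)

Section Words.
Local Open Scope group_scope.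

(** By hypothesis [x] conjugates [a * y] to [y * b], hence also their powers. *)
Lemma mulg_swapX (G : groupType) (x y a b : G) (m : nat) :
  x * a * y = y * b * x -> x * (a * y) ^+ m = (y * b) ^+ m * x.
Proof.
move=> xy; elim: m => [|m IHm]; first by rewrite !expg0 mulg1 mul1g.
by rewrite expgSr mulgA IHm expgSr -!mulgA; congr (_ * _); rewrite !mulgA.
Qed.

(** The passage from one partial product of squares to the next, with [b a^-1] for [z] and
    consecutive [u] for [x] and [y]. *)
Lemma mulg_swap_squares (G : groupType) (z x y a b : G) :
  x * a * y = y * b * x ->
  z * (x * a) * x * ((x^-1 * y) * (x^-1 * y)) = z * (y * b) * y.
Proof.
by move=> xy; rewrite -!mulgA mulVKg; congr (_ * _); rewrite !mulgA xy mulgK.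
Qed.

Lemma fgword_cat (T : choiceType) (s t : seq T) :
  fgword (s ++ t) = fgword s * fgword t.
Proof. exact: big_cat. Qed.

Lemma fgword_flatten_nseq (T : choiceType) (s : seq T) (n : nat) :
  fgword (flatten (nseq n s)) = fgword s ^+ n.
Proof.
by elim: n => [|n IHn]; [exact: big_nil | rewrite /= fgword_cat IHn expgS].
Qed.

Lemma fgval_fgword (T : choiceType) (s : seq T) :
  fgval (fgword s) = [seq (x, true) | x <- s].
Proof.
elim: s => [|x s IHs]; first by rewrite /fgword big_nil.
have -> : fgword (x :: s) = fggen x * fgword s by exact: big_cons.
by rewrite /= IHs; case: s {IHs} => [|y s] //=; rewrite xpair_eqE andbF.
Qed.

(** Equalities of words can thus be proved in the group, where inverses are available. *)
Lemma fgword_inj (T : choiceType) : injective (@fgword T).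
Proof.
move=> s t /(congr1 (@fgval T)); rewrite !fgval_fgword.
by apply: inj_map => x y [].
Qed.

Definition last_two (k : nat) : freeGroup letter :=
  fgword (if odd k then [:: Lb; La] else [:: La; Lb]).

Lemma last_two_SS k : last_two k.+2 = last_two k.
Proof. by rewrite /last_two /= negbK. Qed.

(** * The standard sequence and its quotients *)

Section StandardSequence.
Variable d : nat -> nat.

Local Notation s k := (fgword (sstd d k)).
Local Notation u := (ustd d).
Local Notation e := last_two.

Lemma sstdSS k :
  sstd d k.+2 = flatten (nseq (d k) (sstd d k.+1)) ++ sstd d k.
Proof. by []. Qed.

Lemma fgword_sstd k : s k = u k * e k.
Proof. by rewrite /ustd mulgVK. Qed.

Lemma ustd0 : u 0 = (fgword [:: La])^-1.
Proof.
by rewrite /ustd /= -[[:: La; Lb]]cat1s fgword_cat invgM mulgA mulgV mul1g.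
Qed.

Lemma ustd1 : u 1 = (fgword [:: Lb])^-1.
Proof.
by rewrite /ustd /= -[[:: Lb; La]]cat1s fgword_cat invgM mulgA mulgV mul1g.
Qed.

Lemma ustdSS k : u k.+2 = s k.+1 ^+ d k * u k.
Proof.
by rewrite /ustd sstdSS fgword_cat fgword_flatten_nseq /= negbK mulgA.
Qed.

Lemma ustd_swap k : u k * e k * u k.+1 = u k.+1 * e k.+1 * u k.
Proof.
elim: k => [|k IHk].
  by rewrite -!fgword_sstd ustd0 ustd1 !mulgV.
(* Both sides reduce to [(u k.+1 * e k.+1) ^+ (d k).+1 * u k]. *)
rewrite last_two_SS ustdSS fgword_sstd -!(mulgA (_ ^+ _)) IHk.
by rewrite !mulgA -expgS expgSr !mulgA.
Qed.

(* The reversal of [s_k = u_k xy] is [yx u_k]: this is the palindromicity of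
   [u_k], in a form that also covers the non-positive [u_{-1}] and [u_0]. *)
Lemma fgword_rev_sstd k : fgword (rev (sstd d k)) = e k.+1 * u k.
Proof.
suff [] : fgword (rev (sstd d k)) = e k.+1 * u k /\
          fgword (rev (sstd d k.+1)) = e k.+2 * u k.+1 by [].
elim: k => [|k [IHk IHk1]]; last split=> //.
  split; rewrite ?ustd0 ?ustd1 /last_two /=.
    by rewrite -[[:: Lb; La]]cat1s fgword_cat mulgK.
  by rewrite -[[:: La; Lb]]cat1s fgword_cat mulgK.
rewrite sstdSS rev_cat rev_flatten map_nseq rev_nseq fgword_cat IHk.
rewrite fgword_flatten_nseq IHk1 !last_two_SS ustdSS fgword_sstd.
by rewrite -mulgA (mulg_swapX _ (ustd_swap k)).
Qed.

(* The paper's [u_n^-1 u_{n+1}] as a word; it is the reversal of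
   [s_n^(d_n - 1) s_{n-1}]. *)
Definition std_quotient n : seq letter :=
  rev (flatten (nseq (d n).-1 (sstd d n.+1)) ++ sstd d n).

(** Multiplied on the left by [u n.+1], both sides give [s n.+1 ^+ d n * u n]: the initial
    [u n.+1 * e n.+1] is the missing factor. *)
Lemma fgword_std_quotient n : 0 < d n ->
  fgword (std_quotient n) = (u n.+1)^-1 * u n.+2.
Proof.
move=> dn_gt0; apply: (mulgI (u n.+1)); rewrite mulVKg ustdSS -(prednK dn_gt0).
rewrite /std_quotient rev_cat rev_flatten map_nseq rev_nseq fgword_cat.
rewrite fgword_flatten_nseq !fgword_rev_sstd last_two_SS -(mulgA (e n.+1)).
rewrite (mulg_swapX _ (ustd_swap n)) mulgA.
by rewrite fgword_sstd expgS !mulgA.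
Qed.

(** * Prefixes of the product of squares *)

Hypothesis d_gt0 : forall n, 0 < d n.

(** The recursion has order two, so the bounds on consecutive words are proved together. *)
Lemma size_sstdS k : 0 < size (sstd d k) /\ k < size (sstd d k.+1).
Proof.
elim: k => // k [sk sk1]; split; first exact: leq_ltn_trans sk1.
rewrite sstdSS -(prednK (d_gt0 k)) /= !size_cat -addn1 leq_add //.
exact: leq_trans (leq_addr _ _).
Qed.

Lemma size_sstd_gt0 k : 0 < size (sstd d k).
Proof. by case: (size_sstdS k). Qed.

(** From [sstd d 1] on, each word is a prefix of the next; for [sstd d 2] this uses [0 < d 0]. *)
Lemma head_sstd k : head La (sstd d k.+1) = La.
Proof.
elim: k => // k IHk; rewrite sstdSS -(prednK (d_gt0 k)).
by case: (sstd d k.+1) (size_sstd_gt0 k.+1) IHk.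
Qed.

Lemma std_quotient_neq0 n : std_quotient n != [::].
Proof.
by rewrite -size_eq0 size_rev size_cat -lt0n addn_gt0 size_sstd_gt0 orbT.
Qed.

Lemma std_quotient0 : std_quotient 0 = Lb :: nseq (d 0).-1 La.
Proof.
rewrite /std_quotient rev_cat rev_flatten map_nseq rev_nseq; congr (_ :: _).
by elim: (d 0).-1 => //= m ->.
Qed.

Definition square_prefix N :=
  flatten (mkseq (fun n => std_quotient n ++ std_quotient n) N).

Lemma square_prefixS N : square_prefix N.+1 =
  square_prefix N ++ std_quotient N ++ std_quotient N.
Proof.
by rewrite /square_prefix /mkseq -addn1 iotaD map_cat flatten_cat /= cats0.
Qed.

Lemma fgword_square_prefix N : fgword (square_prefix N) =
  fgword [:: Lb] * (fgword [:: La])^-1 * s N.+1 * u N.+1.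
Proof.
elim: N => [|N IHN].
  by rewrite ustd1 [sstd d 1]/= mulgVK mulgV /fgword big_nil.
rewrite (fgword_sstd N.+2) square_prefixS fgword_cat IHN (fgword_sstd N.+1).
rewrite (fgword_cat (std_quotient N)) fgword_std_quotient //.
exact: mulg_swap_squares (ustd_swap _).
Qed.

(** [u 1] is [b^-1], and the first quotient starts with the [b] that cancels it; the later quotients
    only append letters. *)
Lemma ustd_word N : exists t, u N.+2 = fgword t.
Proof.
elim: N => [|N [t uN]].
  exists (behead (std_quotient 0)); rewrite std_quotient0.
  have := fgword_std_quotient (d_gt0 0); rewrite std_quotient0 ustd1 invgK.
  by rewrite -cat1s fgword_cat => /mulgI.
exists (t ++ std_quotient N.+1).
by rewrite fgword_cat fgword_std_quotient // -uN mulVKg.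
Qed.

Lemma square_prefix_sstd N : exists t,
  square_prefix N.+1 = Lb :: behead (sstd d N.+2) ++ t.
Proof.
have [t uN] := ustd_word N; exists t; apply: fgword_inj.
rewrite fgword_square_prefix uN -cat_cons (fgword_cat (Lb :: _)); congr (_ * _).
(* As the word starts with [a], multiplying by [b a^-1] replaces just that letter. *)
have := head_sstd N.+1; have := size_sstd_gt0 N.+2.
case: (sstd d N.+2) => // x r _ /= ->.
by rewrite -[La :: r]cat1s -[Lb :: r]cat1s !fgword_cat mulgA mulgVK.
Qed.

End StandardSequence.

End Words.

(** * Infinite products *)

Lemma size_flatten_mkseq (T : Type) (v : nat -> seq T) (n : nat) :
  (forall i, 0 < size (v i)) -> n <= size (flatten (mkseq v n)).
Proof.
move=> v_gt0; elim: n => // n IHn.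
by rewrite /mkseq -addn1 iotaD map_cat flatten_cat size_cat leq_add //= cats0.
Qed.

(** The first [i.+1] nonempty factors already cover position [i], so further factors do not change
    its letter. *)
Lemma infprod_nth (v : nat -> seq letter) (n i : nat) :
  (forall j, 0 < size (v j)) -> i < n ->
  infprod v i = nth La (flatten (mkseq v n)) i.
Proof.
move=> v_gt0 /subnKC <-; rewrite [in RHS]/mkseq iotaD map_cat flatten_cat.
by rewrite nth_cat (size_flatten_mkseq i.+1 v_gt0).
Qed.

Lemma infprod_cons (v : nat -> seq letter) :
  (forall j, 0 < size (v j)) ->
  infprod v =1 infcat (v 0) (infprod (v \o succn)).
Proof.
move=> v_gt0 i; rewrite /infcat {1}/infprod.
rewrite /mkseq [iota _ _]/= -[1]addn0 iotaDl [map v _]/= -map_comp.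
rewrite [flatten _]/= nth_cat; case: ltnP => // vi.
(* Only [i] factors remain after [v 0]; they suffice because [v 0] is nonempty. *)
rewrite (@infprod_nth _ i) //.
  by move=> j; exact: v_gt0.
by rewrite ltn_subrL v_gt0 (leq_trans _ vi).
Qed.

(** * Standard words and the product formula *)

Lemma eq_sstd (d d' : nat -> nat) (k : nat) :
  (forall i, i.+1 < k -> d i = d' i) -> sstd d k = sstd d' k.
Proof.
move=> dd'; suff sE j :
    j < k -> sstd d j = sstd d' j /\ sstd d j.+1 = sstd d' j.+1.
  by case: k dd' sE => // k _ /(_ k (ltnSn k)) [].
elim: j => // j IHj jk; have [sj sj1] := IHj (ltnW jk); split=> //.
by rewrite !sstdSS sj sj1 dd'.
Qed.

(* If [d_n = 1] and [n > 0], the word is [s_{n-1}]; otherwise it is [s_{n+1}]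
   for the expansion in which [d_n] is decreased by one. *)
Lemma standard_word_pred (R : realType) (alpha : R) (d : nat -> nat) (n : nat) :
  irrational alpha -> (0 < alpha < 1)%R -> cf_expansion alpha d ->
  standard_word R (flatten (nseq (d n).-1 (sstd d n.+1)) ++ sstd d n).
Proof.
move=> airr a01 ad; have [d_gt0 _] := ad.
have [/andP[n_gt0 /eqP dn]|dn] := boolP ((0 < n) && ((d n).-1 == 0)).
  by exists alpha, d; split=> //; exists n; rewrite dn.
(* At [n = 0] the new value may be 0, which [cf_expansion] allows there. *)
pose d' i := if i == n then (d n).-1 else d i.
have [||beta [birr b01 bd']] := @cf_expansion_eq_tail R alpha d d' n.+1 airr ad.
- move=> i i_gt0; rewrite /d'; case: eqP => [i_n|_]; last exact: d_gt0.
  by move: dn; rewrite -i_n i_gt0 /= lt0n.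
- by move=> i ni; rewrite /d' gtn_eqF.
exists beta, d'; split=> //; exists n.+2; rewrite sstdSS /d' eqxx.
by congr (flatten (nseq _ _) ++ _); apply: eq_sstd => i ilt; rewrite ltn_eqF //;
  apply: ltnW.
Qed.

Theorem theorem18 (R : realType) (alpha : R) (d : nat -> nat) (w : infword)
    (alpha_irr : irrational alpha) (alpha_gt0 : (0 < alpha)%R)
    (alpha_lt : (alpha < 2^-1)%R)
    (alpha_cf : cf_expansion alpha d) (w_std : standard_sturmian alpha w) :
  [/\ 0 < d 0,
      w 0 = La &
      exists v : nat -> seq letter,
        [/\ forall n, fgword (v n) = ((ustd d n.+1)^-1 * ustd d n.+2)%g,
            forall n, v n != [::] /\
                      (exists2 t, standard_word R t & v n = rev t),
            replace_first Lb w =1 infprod (fun n => v n ++ v n) &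
            w =1 infcat (nseq (d 0) La ++ [:: Lb] ++ nseq (d 0).-1 La)
                        (infprod (fun n => v n.+1 ++ v n.+1))]].
Proof.
have d0_gt0 := cf_expansion_head_gt0 alpha_irr alpha_gt0 alpha_lt alpha_cf.
have d_gt0 n : 0 < d n by case: n => // n; case: alpha_cf => + _; exact.
have a01 : (0 < alpha < 1)%R.
  by rewrite alpha_gt0 (lt_trans alpha_lt) // invf_lt1 // ltr1n.
have w_nth i : exists N, forall n, N <= n -> w i = nth La (sstd d n) i.
  (* The expansion behind [w] is [d], by uniqueness. *)
  case: w_std => d' /(cf_expansion_inj alpha_irr alpha_cf) <- /(_ i.+1)[N wN].
  exists N => n /wN /(congr1 (fun s => nth La s i)).
  by rewrite nth_take // nth_mkseq.
have w0 : w 0 = La.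
  by have [N /(_ N.+1 (leqnSn N)) ->] := w_nth 0; rewrite nth0 head_sstd.
pose v := std_quotient d.
have v_gt0 n : 0 < size (v n) by rewrite lt0n size_eq0 std_quotient_neq0.
have vv_gt0 n : 0 < size (v n ++ v n) by rewrite size_cat addn_gt0 v_gt0.
have w_prod : replace_first Lb w =1 infprod (fun n => v n ++ v n).
  move=> i; have [N wN] := w_nth i; pose K := maxn N i.
  have iK : i < K.+1 by rewrite ltnS leq_maxr.
  rewrite (infprod_nth vv_gt0 iK) -/(square_prefix d K.+1).
  have [t ->] := square_prefix_sstd d_gt0 K.
  rewrite /replace_first; case: i wN @K iK => // i wN K iK.
  rewrite (wN K.+2); last by rewrite (leq_trans (leq_maxl N i.+1)) // leqW.
  (* The position lies inside [sstd d K.+2], so the unknown tail is not read. *)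
  have [_ /(ltn_trans iK)] := size_sstdS d_gt0 K.+1.
  by case: (sstd d K.+2) => //= x r; rewrite ltnS nth_cat => ->.
split=> //; exists v; split=> //.
- by move=> n; exact: fgword_std_quotient.
- move=> n; split; first by rewrite std_quotient_neq0.
  eexists; last by [].
  exact: standard_word_pred alpha_irr a01 alpha_cf.
- move=> i.
  have wE : w i = if i == 0 then La else infprod (fun n => v n ++ v n) i.
    by rewrite -w_prod /replace_first; case: eqP => // ->.
  (* The first square is [b a^(d_0-1) b a^(d_0-1)]; restoring its first letter to [a] gives the
     finite prefix. *)
  rewrite wE (infprod_cons vv_gt0) {wE}.
  rewrite [v 0]std_quotient0 -(prednK d0_gt0) /infcat.
  by case: i.
Qed.
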